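(* Let $A=(a_{i,j})$ be an $n\times n$ integer matrix, $\ell$ a canon for $A$, and assume that the $a_{i,i}$, $1\le i\le n$, form a maximal transversal sum, i.e. $\sum_ia_{i,i}=\max_{\sigma\in S_n}\sum_ia_{i,\sigma(i)}$. Let $G$ be the weighted directed graph on the vertices $\{0,1,\dots,n\}$ with weight $w_{i,j}=a_{i,i}+\ell_i-a_{j,i}-\ell_j\ge0$ on the edge $(i,j)$, for $1\le i,j\le n$, $i\neq j$, and weight $w_{i,0}=\ell_i$ on the edge $(i,0)$, $1\le i\le n$. Then a vector of integers $\lambda=(\lambda_1,\dots,\lambda_n)$ is the minimal canon of $A$ if and only if, for all $1\le i\le n$, there exists in $G$ a shortest path of length $\ell_i-\lambda_i$ from vertex $i$ to vertex $0$.
   Context: A canon of $A$ is a vector $\ell$ with all $\ell_i\ge0$ such that the matrix $A+\ell=(a_{i,j}+\ell_i)$ possesses $n$ entries located in pairwise different rows and columns, each maximal in its column. The minimal canon is the least canon for the componentwise order. The length of a path is the sum of the weights of its edges. *)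

(* Defs.v *)
From mathcomp Require Import all_boot all_order all_algebra all_fingroup.

Set Implicit Arguments.
Unset Strict Implicit.
Unset Printing Implicit Defensive.

Import Order.TTheory GRing.Theory Num.Theory.
Local Open Scope ring_scope.

Section Canon.
Variable n : nat.
Implicit Types (A : 'M[int]_n) (l : 'cV[int]_n).

Definition add_rows A l : 'M[int]_n := \matrix_(i, j) (A i j + l i 0).

Definition column_maximal (B : 'M[int]_n) (i j : 'I_n) : Prop :=
  forall k, B k j <= B i j.

(* n entries in pairwise different rows and columns are the
   (i, s i) for a permutation s. *)
Definition is_canon A l : Prop :=
  (forall i, 0 <= l i 0) /\
  (exists s : 'S_n, forall i, column_maximal (add_rows A l) i (s i)).

Definition is_minimal_canon A l : Prop :=
  is_canon A l /\ (forall m, is_canon A m -> forall i, l i 0 <= m i 0).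

Definition transversal_sum A (s : 'S_n) : int := \sum_i A i (s i).

(* Vertices {0, ..., n}: the matrix index i : 'I_n (counted from 0) is the
   vertex lift ord0 i, of value i.+1. *)
Definition vertex (i : 'I_n) : 'I_n.+1 := lift ord0 i.

Definition canon_edge : rel 'I_n.+1 := fun u v => (u != ord0) && (u != v).

(* The value 0 out of ord0 is junk: no edge leaves ord0. *)
Definition canon_weight A l (u v : 'I_n.+1) : int :=
  match unlift ord0 u, unlift ord0 v with
  | Some i, Some j => A i i + l i 0 - A j i - l j 0
  | Some i, None => l i 0
  | None, _ => 0
  end.

End Canon.

Section WeightedGraph.
Variables (V : eqType) (e : rel V) (w : V -> V -> int).

(* As in path.v, the pair (x, p) stands for the vertex sequence x :: p, in
   which vertices may be repeated. *)
Definition path_from_to (x y : V) (p : seq V) : bool :=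
  path e x p && (last x p == y).

Definition path_length (x : V) (p : seq V) : int :=
  \sum_(c <- pairmap w x p) c.

Definition is_shortest_path (x y : V) (p : seq V) : Prop :=
  path_from_to x y p /\
  (forall q, path_from_to x y q -> path_length x p <= path_length x q).

End WeightedGraph.

(* Main.v *)
Require Import Defs.
From mathcomp Require Import all_boot all_order all_algebra all_fingroup.
From mathcomp Require Import zify.

Set Implicit Arguments.
Unset Strict Implicit.
Unset Printing Implicit Defensive.

Import Order.TTheory GRing.Theory Num.Theory.
Local Open Scope ring_scope.

(** The proof is linear programming duality for shortest paths.

    Because the diagonal is a maximal transversal, any other family of column
    maxima in [A + m] has the same sum as the diagonal, so the diagonal itself
    consists of column maxima ([is_canon_diag]).  Hence the canons of [A] are
    exactly the nonnegative [m] such that [A j i + m j <= A i i + m i] for all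
    [i] and [j].  In terms of the differences [l i - m i], extended by [0] at
    the vertex [0], these inequalities say that no edge [(u, v)] of the graph
    has a weight smaller than the drop of the difference along it; the edges
    into [0] encode [0 <= m i].  So [m |-> l - m] is an order-reversing
    bijection from the canons onto the potentials of the graph
    ([is_canon_potential]), and the minimal canon corresponds to the greatest
    potential.

    It remains to see that the greatest potential is the distance to [0]
    ([greatest_potentialP]).  Summing along a path shows that every potential
    is at most the length of any path, and the distances form a potential.
    Conversely, given a greatest potential, call an edge tight when its
    weight is exactly the drop of the potential.  If some vertices could not
    reach [0] along tight edges, the potential could be increased by [1] on all
    of them, since every edge leaving this set has an integer slack of at least
    [1].  So every vertex has a tight path to [0]; its length is the potential,
    which bounds the length of every other path from below. *)

(** * Potentials and shortest paths *)

Section Potential.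
Variables (V : finType) (e : rel V) (w : V -> V -> int) (y : V).
Implicit Types (phi psi : V -> int) (x u v : V) (p : seq V).

Definition is_potential phi : Prop :=
  phi y = 0 /\ (forall u v, e u v -> phi u <= w u v + phi v).

Definition is_greatest_potential phi : Prop :=
  is_potential phi /\
  (forall psi, is_potential psi -> forall x, psi x <= phi x).

Definition tight phi : rel V := [rel u v | e u v && (phi u == w u v + phi v)].

Lemma path_length_nil x : path_length w x [::] = 0.
Proof. by rewrite /path_length big_nil. Qed.

Lemma path_length_cons x v p :
  path_length w x (v :: p) = w x v + path_length w v p.
Proof. by rewrite /path_length /= big_cons. Qed.

Lemma potential_le_path_length phi x p :
  is_potential phi -> path_from_to e x y p -> phi x <= path_length w x p.
Proof.
move=> [phi_y phi_e] /andP[].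
elim: p x => [|v p IHp] x /=.
  by move=> _ /eqP->; rewrite phi_y path_length_nil.
move=> /andP[exv pv /(IHp v pv) le_v]; rewrite path_length_cons.
by apply: le_trans (phi_e _ _ exv) _; rewrite lerD2l.
Qed.

Lemma tight_path_length phi x p :
  phi y = 0 -> path_from_to (tight phi) x y p -> path_length w x p = phi x.
Proof.
move=> phi_y /andP[].
elim: p x => [|v p IHp] x /=.
  by move=> _ /eqP->; rewrite path_length_nil phi_y.
move=> /andP[/andP[_ /eqP->] pv last_p].
by rewrite path_length_cons IHp.
Qed.

Lemma tight_path_shortest phi x p :
    is_potential phi -> path_from_to (tight phi) x y p ->
  is_shortest_path e w x y p.
Proof.
move=> phi_pot tight_p; split=> [|q e_q].
  case/andP: tight_p => path_p last_p; rewrite /path_from_to last_p andbT.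
  by apply: sub_path path_p => u v /andP[].
rewrite (tight_path_length phi_pot.1 tight_p).
exact: potential_le_path_length.
Qed.

(** An edge from outside to inside the set of vertices that reach [y] along
    tight edges is not tight, so over the integers its slack is at least [1]:
    raising the potential by [1] outside this set breaks no inequality. *)
Lemma raise_potential phi :
    is_potential phi ->
  is_potential (fun u => phi u + (~~ connect (tight phi) u y)%:Z).
Proof.
move=> [phi_y phi_e]; split=> [|u v euv]; first by rewrite connect0 phi_y.
have := phi_e u v euv.
case yv: (connect (tight phi) v y); case yu: (connect (tight phi) u y) => /=;
  rewrite ?addr0 //; try lia.
have not_tight : phi u != w u v + phi v.
  apply: contraFneq yu => tight_uv; apply: connect_trans yv.
  by apply: connect1; rewrite /tight /= euv tight_uv eqxx.
by move: not_tight; lia.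
Qed.

Lemma greatest_potential_tight phi x :
  is_greatest_potential phi -> connect (tight phi) x y.
Proof.
move=> [phi_pot phi_max].
have /= := phi_max _ (raise_potential phi_pot) x.
by case: connect => //=; lia.
Qed.

Lemma greatest_potentialP phi (phi_y : phi y = 0) :
  is_greatest_potential phi <->
  (forall x, exists p, is_shortest_path e w x y p /\
                       path_length w x p = phi x).
Proof.
split=> [phi_great x | phi_dist].
  have /connectP[p path_p last_p] := greatest_potential_tight x phi_great.
  have tight_p : path_from_to (tight phi) x y p.
    by rewrite /path_from_to path_p last_p /=.
  exists p; split; last exact: tight_path_length.
  exact: tight_path_shortest phi_great.1 tight_p.
split=> [|psi psi_pot x]; last first.
  have [p [[e_p _] <-]] := phi_dist x; exact: potential_le_path_length.
split=> // u v euv.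
have [p [[_ p_min] <-]] := phi_dist u.
have [q [[/andP[path_q last_q] _] <-]] := phi_dist v.
by rewrite -path_length_cons p_min // /path_from_to /= euv path_q.
Qed.

End Potential.

(** * Canons as potentials *)

Section CanonPotential.
Variables (n : nat) (A : 'M[int]_n).
Implicit Types (l m c : 'cV[int]_n) (i j k : 'I_n).

(** In each column, replacing the entry selected by [s] with the diagonal one
    cannot increase it, as the former is maximal. Nor can the sum decrease: over
    any transversal, the sums for [A] and [A + m] differ by the same constant.
    So the two entries of each column are equal. *)
Lemma column_maximal_diag m (s : 'S_n) :
    (forall t : 'S_n, transversal_sum A t <= \sum_i A i i) ->
    (forall i, column_maximal (add_rows A m) i (s i)) ->
  forall i, column_maximal (add_rows A m) i i.
Proof.
set B := add_rows A m => diag_max s_max.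
have s_maxV j k : B k j <= B ((s^-1)%g j) j.
  by have := s_max ((s^-1)%g j) k; rewrite permKV.
have le_sum : \sum_j B ((s^-1)%g j) j <= \sum_j B j j.
  rewrite (reindex_inj (@perm_inj _ s)) /=.
  under eq_bigr => j _ do rewrite permK mxE.
  under [leRHS]eq_bigr => j _ do rewrite mxE.
  by rewrite !big_split /= lerD2r; apply: diag_max.
have gap_ge0 j : true -> 0 <= B ((s^-1)%g j) j - B j j.
  by rewrite subr_ge0.
have gap_sum : \sum_j (B ((s^-1)%g j) j - B j j) == 0.
  by rewrite eq_le sumr_ge0 // sumrB subr_le0 le_sum.
move=> i k; have := s_maxV i k.
move: gap_sum; rewrite psumr_eq0 // => /allP/(_ i (mem_index_enum i)).
by rewrite /= subr_eq0 => /eqP->.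
Qed.

Lemma is_canon_diag m :
    (forall s : 'S_n, transversal_sum A s <= \sum_i A i i) ->
  is_canon A m <->
  (forall i, 0 <= m i 0) /\ (forall i j, A j i + m j 0 <= A i i + m i 0).
Proof.
move=> diag_max; split=> [[m_ge0 [s s_max]] | [m_ge0 diag]]; split=> //.
  move=> i j; have := column_maximal_diag diag_max s_max i j.
  by rewrite !mxE.
by exists 1%g => i k; rewrite perm1 !mxE.
Qed.

Definition canon_potential l m (u : 'I_n.+1) : int :=
  if unlift ord0 u is Some i then l i 0 - m i 0 else 0.

Lemma canon_potential0 l m : canon_potential l m ord0 = 0.
Proof. by rewrite /canon_potential unlift_none. Qed.

Lemma canon_potential_vertex l m i :
  canon_potential l m (vertex i) = l i 0 - m i 0.
Proof. by rewrite /canon_potential liftK. Qed.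

Lemma canon_weight_vertex l i j :
  canon_weight A l (vertex i) (vertex j) = A i i + l i 0 - A j i - l j 0.
Proof. by rewrite /canon_weight !liftK. Qed.

Lemma canon_weight0 l i : canon_weight A l (vertex i) ord0 = l i 0.
Proof. by rewrite /canon_weight liftK unlift_none. Qed.

Lemma canon_edge_vertex i j : canon_edge (vertex i) (vertex j) = (i != j).
Proof. by rewrite /canon_edge (inj_eq (@lift_inj _ ord0)). Qed.

Lemma canon_edge0 i : canon_edge (vertex i) ord0.
Proof. by []. Qed.

Lemma canon_path_from0 (y : 'I_n.+1) p :
  path_from_to (@canon_edge n) ord0 y p -> p = [::].
Proof. by case: p. Qed.

Lemma is_canon_potential l m :
    (forall s : 'S_n, transversal_sum A s <= \sum_i A i i) ->
  is_canon A m <->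
  is_potential (@canon_edge n) (canon_weight A l) ord0 (canon_potential l m).
Proof.
move=> diag_max; apply: (iff_trans (is_canon_diag m diag_max)).
split=> [[m_ge0 diag] | [_ pot]].
  split=> [|u v]; first exact: canon_potential0.
  case: (unliftP ord0 u) => [i ->|->] //.
  case: (unliftP ord0 v) => [j ->|->] _; rewrite -!/(vertex _).
    rewrite !canon_potential_vertex canon_weight_vertex.
    by have := diag i j; lia.
  rewrite canon_potential_vertex canon_weight0 canon_potential0.
  by have := m_ge0 i; lia.
split=> [i | i j].
  have := pot _ _ (canon_edge0 i).
  by rewrite canon_potential_vertex canon_weight0 canon_potential0; lia.
have [-> // | ij] := eqVneq i j.
have := pot (vertex i) (vertex j); rewrite canon_edge_vertex => /(_ ij).
by rewrite !canon_potential_vertex canon_weight_vertex; lia.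
Qed.

Lemma is_minimal_canon_potential l m :
    (forall s : 'S_n, transversal_sum A s <= \sum_i A i i) ->
  is_minimal_canon A m <->
  is_greatest_potential (@canon_edge n) (canon_weight A l) ord0
    (canon_potential l m).
Proof.
move=> diag_max; have canonP c := is_canon_potential l c diag_max.
split=> [[/canonP m_pot m_min] | [/canonP m_canon m_max]]; split=> //.
  move=> psi psi_pot.
  (* The potential psi is itself of the form l - c, so that the minimality of
     m can be applied to the canon c. *)
  pose c : 'cV[int]_n := \col_i (l i 0 - psi (vertex i)).
  have psiE : psi =1 canon_potential l c.
    move=> u; case: (unliftP ord0 u) => [i|] ->.
      by rewrite canon_potential_vertex mxE subKr.
    by rewrite canon_potential0 psi_pot.1.
  have /canonP c_canon : is_potential (@canon_edge n) (canon_weight A l) ord0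
      (canon_potential l c).
    split=> [|u v]; first exact: canon_potential0.
    by rewrite -!psiE; apply: psi_pot.2.
  move=> u; rewrite psiE; case: (unliftP ord0 u) => [i|] ->.
    by rewrite !canon_potential_vertex lerD2l lerN2 m_min.
  by rewrite !canon_potential0.
move=> c /canonP c_pot i.
by have := m_max _ c_pot (vertex i); rewrite !canon_potential_vertex; lia.
Qed.

End CanonPotential.

Unset Implicit Arguments.

Theorem proposition69 (n : nat) (A : 'M[int]_n) (l : 'cV[int]_n)
    (l_canon : is_canon A l)
    (diag_max : forall s : 'S_n, transversal_sum A s <= \sum_i A i i) :
  (forall i j : 'I_n, i != j ->
     0 <= canon_weight A l (vertex i) (vertex j)) /\
  (forall lam : 'cV[int]_n,
     is_minimal_canon A lam <->
     (forall i : 'I_n, exists p : seq 'I_n.+1,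
        is_shortest_path (@canon_edge n) (canon_weight A l) (vertex i) ord0 p /\
        path_length (canon_weight A l) (vertex i) p = l i 0 - lam i 0)).
Proof.
split=> [i j _ | lam].
  have [_ diag] := (is_canon_diag l diag_max).1 l_canon.
  by rewrite canon_weight_vertex; have := diag i j; lia.
apply: (iff_trans (is_minimal_canon_potential l lam diag_max)).
apply: (iff_trans (greatest_potentialP _ _ (canon_potential0 l lam))).
split=> [dist i | dist u].
  by have := dist (vertex i); rewrite canon_potential_vertex.
case: (unliftP ord0 u) => [i|] ->.
  by rewrite canon_potential_vertex; apply: dist.
(* Any path from the vertex 0, which has no outgoing edge, is empty. *)
exists [::]; rewrite canon_potential0 path_length_nil; split=> //.
by split=> [|q /canon_path_from0->]; rewrite ?/path_from_to ?eqxx.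
Qed.
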